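(* There exists a constant $c > 0$ such that $$\Psi(r) \ge 2^{r-1} + c\, r\, 2^{r/2}$$ for all sufficiently large $r$.
   Context: For a finite connected graph $G=(V,E)$, its cyclomatic number is $r(G)=|E|-|V|+1$. $\Psi(r)$ denotes the maximum number of cycles (counted as subgraphs) in a connected graph $G$ with cyclomatic number $r(G)=r$; it is finite because the number of cycles in $G$ is at most $2^{r(G)}-1$. *)

(* Defs.v *)
From HB Require Import structures.
From mathcomp Require Import all_boot all_order all_algebra.
From mathcomp Require Import all_fingroup mxabelem.
From mathcomp Require Import boolp.

Set Implicit Arguments.
Unset Strict Implicit.
Unset Printing Implicit Defensive.

Import Order.TTheory GRing.Theory Num.Theory.
Local Open Scope ring_scope.

Record sgraph := SGraph {
  vertex :> finType;
  adj : rel vertex;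
  adj_sym : symmetric adj;
  adj_irrefl : irreflexive adj
}.

Definition edges (G : sgraph) : {set {set G}} :=
  [set [set p.1; p.2] | p : G * G & adj p.1 p.2].

Definition connected (G : sgraph) : bool :=
  (0 < #|G|)%N && [forall x : G, forall y : G, connect (@adj G) x y].

(* Integer-valued, so that no truncated subtraction occurs. *)
Definition cyclomatic (G : sgraph) : int := #|edges G|%:Z - #|G|%:Z + 1.

Definition cycle_edges (T : finType) (c : seq T) : {set {set T}} :=
  [set [set x; next c x] | x in c].

(* A cycle has no isolated vertex, so as a subgraph it is determined by its   *)
(* edge set; rotations and reversals of the vertex sequence c are identified. *)
Definition cycles (G : sgraph) : {set {set {set G}}} :=
  [set C : {set {set G}} | `[< exists c : seq G,
     [/\ ucycle (@adj G) c, (2 < size c)%N & C = cycle_edges c] >]].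

Definition attained (r : nat) : pred nat := fun m =>
  `[< exists G : sgraph,
        [/\ connected G, cyclomatic G = r%:Z & #|cycles G| = m] >].

(* The complete bipartite graph K_(2, r+1) has cyclomatic number r. *)
Section Attained.
Variable r : nat.
Let T : finType := (bool + 'I_r.+1)%type.
Let e : rel T := fun x y =>
  match x, y with inl _, inr _ | inr _, inl _ => true | _, _ => false end.

Let e_sym : symmetric e. Proof. by case=> ? []. Qed.
Let e_irr : irreflexive e. Proof. by case. Qed.

Lemma exists_attained : exists m, attained r m.
Proof.
exists #|cycles (SGraph e_sym e_irr)|; apply/asboolP.
exists (SGraph e_sym e_irr); split=> //.
- rewrite /connected card_sum card_bool /=.
  have cl b i : connect e (inl b) (inr i) by exact: connect1.
  have cr b i : connect e (inr i) (inl b) by exact: connect1.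
  apply/forallP => x; apply/forallP => y.
  case: x y => [b|i] [b'|i'] //=.
  + exact: connect_trans (cl b ord0) (cr b' ord0).
  + exact: connect_trans (cr true i) (cl true i').
rewrite /cyclomatic.
pose f (p : bool * 'I_r.+1) : {set T} := [set inl p.1; inr p.2].
have f_inj : injective f.
  move=> [b i] [b' i'] /setP fE.
  have := fE (inl b); have := fE (inr i).
  by rewrite !inE /= !eqxx /= => /esym/eqP [->] /esym; rewrite orbF => /eqP [->].
have -> : edges (SGraph e_sym e_irr) = [set f p | p in predT].
  apply/setP => X; apply/imsetP/imsetP => [[[x y]]|[[b i] _ ->]].
    rewrite inE /=; case: x y => [b|i] [b'|i'] //= _ ->.
      by exists (b, i').
    by exists (b', i) => //; rewrite /f setUC.
  by exists (inl b, inr i); rewrite ?inE.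
rewrite card_imset // card_prod card_sum card_bool card_ord.
rewrite -[X in _ + X]/(1%:Z) addrAC -PoszD; apply/eqP; rewrite subr_eq -PoszD.
by apply/eqP; congr Posz; rewrite mul2n -addnn !addnS !addSn !addn0.
Qed.

End Attained.

(* The number of cycles of a connected graph G is at most 2 ^ r(G) - 1: the   *)
(* indicators of the cycles are nonzero vectors in the kernel over F_2 of the *)
(* incidence matrix, which has dimension r(G).                                *)
Section CycleBound.
Variable G : sgraph.

Lemma next_next_neq (c : seq G) (x : G) :
  uniq c -> (2 < size c)%N -> x \in c -> next c (next c x) != x.
Proof.
move=> Uc sc xc; have [i s Dc] := rot_to xc.
rewrite -!(next_rot i Uc) Dc.
have: (2 < size (x :: s))%N by rewrite -Dc size_rot.
have: uniq (x :: s) by rewrite -Dc rot_uniq.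
case: s {Dc} => [|y [|z s]] //= /andP [xN /andP[yN _]] _.
rewrite eqxx; move: xN; rewrite !inE !negb_or => /and3P [xy xz _].
by rewrite [y == x]eq_sym (negbTE xy) eqxx eq_sym.
Qed.

Lemma cycle_edges_inj (c : seq G) : uniq c -> (2 < size c)%N ->
  {in c &, injective (fun x => [set x; next c x])}.
Proof.
move=> Uc sc x y xc yc /setP E; apply/eqP; apply/negPn/negP => nxy.
have := E x; rewrite !inE eqxx (negbTE nxy) /= => /esym/eqP xy.
have := E y; rewrite !inE eqxx eq_sym (negbTE nxy) /= => /eqP yx.
by have := next_next_neq Uc sc xc; rewrite -yx -xy eqxx.
Qed.

Lemma cycle_edges_sub (c : seq G) :
  ucycle (@adj G) c -> cycle_edges c \subset edges G.
Proof.
move=> /andP [cc _]; apply/subsetP => X /imsetP [x xc ->].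
by apply/imsetP; exists (x, next c x); rewrite ?inE //=; apply: next_cycle.
Qed.

Lemma char2 (a : 'F_2) : a + a = 0.
Proof. by have := addrr_pchar2 (pchar_Fp (isT : prime 2)) a. Qed.

Lemma cycle_edges_even (c : seq G) (v : G) :
  ucycle (@adj G) c -> (2 < size c)%N ->
  \sum_(X in cycle_edges c) (v \in X)%:R = 0 :> 'F_2.
Proof.
move=> /andP [cc Uc] sc.
rewrite big_imset /=; last exact: cycle_edges_inj.
transitivity (\sum_(x in c) ((v == x)%:R + (v == next c x)%:R) : 'F_2).
  apply: eq_bigr => x xc; rewrite !inE.
  case: (eqVneq v x) => [->|_] /=; last by rewrite add0r.
  case: eqP => [xE|_]; last by rewrite addr0.
  by have := next_cycle cc xc; rewrite -xE adj_irrefl.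
rewrite big_split /=.
rewrite [X in X + _](reindex_onto (next c) (prev c)) /=; last first.
  by move=> x _; rewrite next_prev.
rewrite [X in X + _](eq_bigl (mem c)) ?char2 // => x.
by rewrite mem_next prev_next // eqxx andbT.
Qed.

Let m := #|edges G|.
Let A : 'M['F_2]_(m, #|G|) :=
  \matrix_(i, j) (enum_val j \in (enum_val i : {set G}))%:R.

Let rankA : connected G -> (#|G| <= (\rank A).+1)%N.
Proof.
move=> /andP [_ /forallP conG].
have : (\rank (kermx A^T) <= 1)%N.
  suff /mxrankS/leq_trans : (kermx A^T <= (const_mx 1 : 'rV['F_2]_#|G|))%MS.
    by apply; exact: rank_leq_row.
  apply/row_subP => i.
  have : row i (kermx A^T) *m A^T = 0 by rewrite -row_mul mulmx_ker row0.
  move: (row i _) => u uA.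
  have uadj x y : adj x y -> u 0 (enum_rank x) = u 0 (enum_rank y).
    move=> xy; have Exy : [set x; y] \in edges G.
      by apply/imsetP; exists (x, y); rewrite ?inE.
    have nxy : x != y by apply/eqP => E; move: xy; rewrite E adj_irrefl.
    have /matrixP/(_ 0 (enum_rank_in Exy [set x; y])) := uA.
    rewrite !mxE (reindex_onto enum_rank enum_val) /=; last first.
      by move=> j _; rewrite enum_valK.
    rewrite (eq_bigl predT) => [|z]; last by rewrite enum_rankK eqxx.
    rewrite (bigD1 x) // (bigD1 y) 1?eq_sym //= big1 => [|z /andP [zx zy]].
      rewrite !mxE !enum_rankK enum_rankK_in // !inE !eqxx orbT !mulr1 addr0.
      by move=> xy0; apply: (addIr (u 0 (enum_rank y))); rewrite char2.
    by rewrite !mxE enum_rankK enum_rankK_in // !inE (negbTE zx) (negbTE zy) mulr0.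
  have ucon x y : connect (@adj G) x y -> u 0 (enum_rank x) = u 0 (enum_rank y).
    move=> /connectP [p]; elim: p x => [|z p IH] x /= => [_ -> //|].
    by move=> /andP [xz zp] yE; rewrite (uadj _ _ xz); apply: IH.
  have [j0|n0] := pickP (predT : pred 'I_#|G|); last first.
    by have -> : u = 0; [apply/matrixP => a j; have := n0 j | exact: sub0mx].
  move=> _; have -> : u = u 0 j0 *: const_mx 1; last exact: scalemx_sub.
  apply/matrixP => a j; rewrite ord1 [RHS]mxE [X in _ * X]mxE mulr1.
  rewrite -(enum_valK j) -(enum_valK j0); apply: ucon.
  by have /forallP := conG (enum_val j); apply.
by rewrite mxrank_ker mxrank_tr leq_subLR addn1.
Qed.

Lemma card_cycles_le (r : nat) :
  connected G -> cyclomatic G = r%:Z -> (#|cycles G| <= 2 ^ r - 1)%N.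
Proof.
move=> conG rG.
pose u (C : {set {set G}}) : 'rV['F_2]_m := \row_i (enum_val i \in C)%:R.
have subE C : C \in cycles G -> C \subset edges G.
  by rewrite inE => /asboolP [c [uc _ ->]]; exact: cycle_edges_sub.
have u_inj : {in cycles G &, injective u}.
  move=> C D /subE/subsetP sC /subE/subsetP sD /matrixP uE; apply/setP => X.
  have [XE|XN] := boolP (X \in edges G); last first.
    by rewrite (contraNF (sC X)) // (contraNF (sD X)).
  have := uE 0 (enum_rank_in XE X); rewrite !mxE enum_rankK_in //.
  by case: (X \in C); case: (X \in D) => // /eqP.
rewrite -(card_in_imset u_inj).
have sub : u @: cycles G \subset rowg (kermx A) :\ 0.
  apply/subsetP => _ /imsetP [C CG ->]; have sC := subE _ CG.
  move: CG; rewrite inE => /asboolP [c [uc sc CE]]; rewrite in_setD1 mem_rowg.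
  apply/andP; split.
    have [x xc] : exists x, x \in c by case: c sc {uc CE} => // x c _; exists x; rewrite mem_head.
    have XC : [set x; next c x] \in C by rewrite CE; apply: imset_f.
    have XE := subsetP sC _ XC.
    apply/eqP => /matrixP/(_ 0 (enum_rank_in XE [set x; next c x])).
    by rewrite !mxE enum_rankK_in // XC => /eqP.
  apply/sub_kermxP/matrixP => a j; rewrite !mxE.
  rewrite -[RHS](cycle_edges_even (enum_val j) uc sc) -CE.
  rewrite (big_setID (edges G)) /= (setIidPl sC).
  rewrite [X in _ = _ + X]big1 => [|X]; last first.
    by rewrite inE => /andP [/negP XN /(subsetP sC)].
  rewrite addr0 [RHS]big_mkcond /= [RHS](bigID (mem (edges G))) /=.
  rewrite [X in _ = _ + X]big1 => [|X XN]; last first.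
    by rewrite (contraNF (subsetP sC X)).
  rewrite addr0 [RHS]big_enum_val /=; apply: eq_bigr => i _.
  by rewrite !mxE; case: (_ \in C); rewrite ?mul1r ?mul0r.
apply: leq_trans (subset_leq_card sub) _.
have : #|rowg (kermx A)| = (#|rowg (kermx A) :\ 0%R|).+1.
  by rewrite (cardsD1 0) mem_rowg sub0mx.
rewrite card_rowg card_Fp // => cE.
rewrite leq_subRL ?expn_gt0 // add1n -cE leq_exp2l // mxrank_ker.
move: rG; rewrite /cyclomatic => /eqP.
rewrite addrAC subr_eq -!PoszD => /eqP [] mE.
by rewrite leq_subLR -ltnS -[(m).+1]addn1 /m mE addnC -addSn leq_add2r rankA.
Qed.

End CycleBound.

Lemma attained_le (r m : nat) : attained r m -> (m <= 2 ^ r - 1)%N.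
Proof. by move=> /asboolP [G [conG rG <-]]; exact: card_cycles_le. Qed.

Definition Psi (r : nat) : nat :=
  ex_maxn (exists_attained r) (@attained_le r).

(* Main.v *)
Require Import Defs.
From mathcomp Require Import all_boot all_order all_algebra.
From mathcomp Require Import reals exp.
From mathcomp Require Import boolp zify.

Import Order.TTheory GRing.Theory Num.Theory.
Local Open Scope ring_scope.

(** Put L = r - 1 and let G be two disjoint L-cycles ("rails") on the layers
    0, ..., L-1, joined by the perfect matching (t, false) - (p t, true), where
    p exchanges 2k and 2k+1 and fixes L-1 when L is odd.  Thus the layers 2k and
    2k+1 induce a 4-cycle, consecutive 4-cycles are joined by two connectors,
    and for odd L there is one extra rung.  G has cyclomatic number L + 1 = r.

    A cycle winding once around G may enter and leave each 4-cycle on either side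
    and traverse it along 1 or 3 edges: this gives exactly 2^L = 2^(r-1) cycles.
    Other cycles go around almost the whole ring and come back: they traverse
    a 4-cycle by two disjoint paths, again in 2 ways, and make their two
    U-turns in neighbouring 4-cycles.  As the place of the U-turns is free,
    there are about (r/2) 2^(r/2) of them. *)

(** * Cyclic sequences, their undirected edges, and cycles glued from pieces *)

Section Cycles.
Local Open Scope nat_scope.

(** Membership is tested because [next c a] is [a] itself when [a] is not on [c]. *)
Definition consecutive {T : eqType} (c : seq T) (a b : T) : bool :=
  (a \in c) && (next c a == b) || (b \in c) && (next c b == a).

Lemma consecutive_mem (T : eqType) (c : seq T) (a b : T) :
  consecutive c a b -> a \in c.
Proof. by case/orP=> /andP [cH /eqP nE] //; rewrite -nE mem_next. Qed.

Lemma consecutive_map (S T : eqType) (f : S -> T) (c : seq S) (x y : S) :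
  injective f -> uniq c ->
  consecutive [seq f z | z <- c] (f x) (f y) = consecutive c x y.
Proof.
by move=> fI uc; rewrite /consecutive !mem_map // !next_map // !(inj_eq fI).
Qed.

Lemma fcycle_next_eq (T : eqType) (f : T -> T) (c : seq T) (x : T) :
  fcycle f c -> x \in c -> next c x = f x.
Proof. by move=> fc xc; apply/esym/eqP/(next_cycle fc xc). Qed.

Lemma path_flatten_map (T : eqType) (e : rel T) (X : nat -> T)
    (piece : nat -> seq T) (n : nat) :
  (forall k, k < n ->
     path e (X k) (piece k) /\ last (X k) (piece k) = X k.+1) ->
  path e (X 0) (flatten [seq piece k | k <- iota 0 n]) /\
  last (X 0) (flatten [seq piece k | k <- iota 0 n]) = X n.
Proof.
elim: n => [//|n IH] H.
have [k kn|p1 l1] := IH; first by apply: H; lia.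
have [p2 l2] := H n (ltnSn n).
rewrite -[n.+1]addn1 iotaD map_cat flatten_cat cat_path last_cat /= cats0 add0n.
by rewrite p1 l1 p2 l2 addn1.
Qed.

Lemma cycle_flatten_map (T : eqType) (e : rel T) (X : nat -> T)
    (piece : nat -> seq T) (n : nat) :
  X 0 = X n ->
  (forall k, k < n ->
     path e (X k) (piece k) /\ last (X k) (piece k) = X k.+1) ->
  cycle e (flatten [seq piece k | k <- iota 0 n]).
Proof.
move=> X0 /path_flatten_map [p l]; rewrite (cycle_path (X 0)) l -X0; exact: p.
Qed.

Lemma uniq_flatten_map (T : eqType) (key : T -> nat) (piece : nat -> seq T)
    (s : seq nat) :
  uniq s -> (forall k, k \in s -> uniq (piece k)) ->
  (forall k x, x \in piece k -> key x = k) ->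
  uniq (flatten [seq piece k | k <- s]).
Proof.
move=> + + keyE; elim: s => //= k s IH /andP [ks us] H.
rewrite cat_uniq H ?mem_head //= IH // => [|j js]; last first.
  by apply: H; rewrite inE js orbT.
rewrite andbT; apply/hasPn => x /flatten_mapP [j js xj] /=.
by apply: contra ks => /keyE <-; rewrite (keyE _ _ xj).
Qed.

Lemma cycle_edgesE (T : finType) (c : seq T) (x y : T) :
  ([set x; y] \in cycle_edges c) = consecutive c x y.
Proof.
apply/imsetP/idP => [[z zc /setP E]|/orP [] /andP [ac /eqP <-]].
- have := E x; have := E y; have := E z; have := E (next c z).
  rewrite /consecutive !inE !eqxx /= !orbT.
  move=> nE zE /esym/orP [] /eqP yE /esym/orP [] /eqP xE; subst x y.
  (* Here [x] and [y] coincide, which forces [z] to be its own successor. *)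
  + by move: nE; rewrite orbb => /eqP ->; rewrite zc eqxx.
  + by rewrite zc eqxx orbT.
  + by rewrite zc eqxx.
  + by move: zE; rewrite orbb => /eqP zE; rewrite -!zE zc eqxx.
- by exists x.
- by exists y => //; rewrite setUC.
Qed.

End Cycles.

(** * Layers of the ring and the adjacency relation *)

Section Ring.
Local Open Scope nat_scope.

Definition succ_layer (L t : nat) : nat := if t.+1 < L then t.+1 else 0.

Definition cross_layer (L t : nat) : nat :=
  if odd t then t.-1 else if t.+1 < L then t.+1 else t.

(** Layers are natural numbers here, not ordinals, so that adjacency reduces to linear
    arithmetic. *)
Definition ring_rel (L : nat) : rel (nat * bool) := fun a b =>
  if a.2 == b.2 then (b.1 == succ_layer L a.1) || (a.1 == succ_layer L b.1)
  else b.1 == cross_layer L a.1.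

End Ring.

Ltac layers := rewrite /cross_layer /succ_layer;
  repeat match goal with |- context [if ?b then _ else _] =>
    lazymatch b with
    | context [if _ then _ else _] => fail
    | _ => case: (boolP b) => ?
    end end; try lia.

(** * The graph, its cyclomatic number, and the lifting of layered cycles *)

Section RingGraph.
Local Open Scope nat_scope.
Variables (L : nat) (L_ge : 2 < L).

Let T : finType := ('I_L * bool)%type.

Definition layer_val (x : 'I_L * bool) : nat * bool := (val x.1, x.2).

Definition ring_adj : rel T := fun x y =>
  ring_rel L (layer_val x) (layer_val y).

Lemma cross_layerK (t : nat) : t < L -> cross_layer L (cross_layer L t) = t.
Proof. by layers. Qed.

Lemma cross_layer_lt (t : nat) : t < L -> cross_layer L t < L.
Proof. by layers. Qed.

Lemma succ_layer_lt (t : nat) : succ_layer L t < L.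
Proof. by layers. Qed.

Lemma ring_rel_sym (a b : nat * bool) : a.1 < L -> b.1 < L ->
  ring_rel L a b = ring_rel L b a.
Proof.
move=> aL bL; rewrite /ring_rel eq_sym; case: eqP => _; first by rewrite orbC.
by apply/eqP/eqP => ->; rewrite cross_layerK.
Qed.

Lemma ring_adj_sym : symmetric ring_adj.
Proof. by move=> x y; apply: ring_rel_sym => /=. Qed.

Lemma ring_adj_irrefl : irreflexive ring_adj.
Proof.
move=> x; rewrite /ring_adj /ring_rel eqxx /= orbb.
by apply/eqP; layers.
Qed.

Definition ring_graph : sgraph := SGraph ring_adj_sym ring_adj_irrefl.

Lemma layer_val_inj : injective layer_val.
Proof. by move=> [t s] [t' s'] [] /val_inj -> ->. Qed.

Lemma ring_graph_connected : connected ring_graph.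
Proof.
have L_gt0 : 0 < L by lia.
pose o : 'I_L := Ordinal L_gt0.
have one_lt : 1 < L by lia.
rewrite /connected card_prod card_ord card_bool muln_gt0 L_gt0 /=.
have up s n : forall (nL : n < L), connect ring_adj (o, s) (Ordinal nL, s).
  elim: n => [|n IH] nL.
    by apply/eq_connect0; congr (_, _); apply: val_inj.
  have nL' : n < L by lia.
  apply: connect_trans (IH nL') _; apply: connect1.
  by rewrite /ring_adj /ring_rel eqxx /=; layers.
have cs := sym_connect_sym ring_adj_sym.
(* The matching edge at layer 0 leads to layer 1 of the other rail, and [up] leads from there back
   to layer 0. *)
have flip : connect ring_adj (o, false) (o, true).
  apply: (connect_trans (y := (Ordinal one_lt, true))).
    by apply: connect1; rewrite /ring_adj /ring_rel /=; layers.
  by rewrite cs; apply: up.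
have all x : connect ring_adj (o, false) x.
  by case: x => -[t tL] []; [apply: connect_trans flip _|]; apply: up.
apply/forallP => x; apply/forallP => y.
by apply: connect_trans (all y); rewrite cs; apply: all.
Qed.

(** There are [2L] rail edges, [L] matching edges and [2L] vertices. *)
Lemma ring_graph_cyclomatic : cyclomatic ring_graph = L.+1%:Z%R.
Proof.
pose su (t : 'I_L) : 'I_L := Ordinal (succ_layer_lt t).
pose cr (t : 'I_L) : 'I_L := Ordinal (cross_layer_lt t (ltn_ord t)).
pose f (i : (bool * 'I_L) + 'I_L) : {set T} :=
  match i with
  | inl p => [set (p.2, p.1); (su p.2, p.1)]
  | inr t => [set (t, false); (cr t, true)]
  end.
have f_inj : injective f.
  have suN t : su t != t by rewrite -val_eqE /=; layers.
  (* For [L = 2] the two edges of a rail would coincide; [2 < L] rules this out. *)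
  have susuN t t' : su t = t' -> su t' = t -> False.
    by move=> /(congr1 val) /= + /(congr1 val) /=; layers.
  move=> [[s t]|t] [[s' t']|t'] /setP E.
  - have := E (t, s); have := E (su t, s).
    rewrite !inE !xpair_eqE !eqxx /= !orbT.
    case: (eqVneq s s') => [<-|]; last by rewrite !andbF.
    rewrite !andbT => /esym su_t /esym /orP [/eqP -> //|/eqP tE].
    case/orP: su_t => [/eqP suE|]; last by rewrite -tE (negbTE (suN t)).
    by case: (susuN t t').
  - have := E (t', ~~ s); rewrite !inE !xpair_eqE.
    have := E (cr t', ~~ s); rewrite !inE !xpair_eqE.
    by case: s {E}; rewrite /= ?eqxx ?andbF //=.
  - have := E (t, ~~ s'); rewrite !inE !xpair_eqE.
    have := E (cr t, ~~ s'); rewrite !inE !xpair_eqE.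
    by case: s' {E}; rewrite /= ?eqxx ?andbF //=.
  - have := E (t, false); rewrite !inE !xpair_eqE eqxx ?andbF ?andbT ?orbF /=.
    by move=> /esym/eqP ->.
have edgesE : edges ring_graph = [set f i | i in predT].
  apply/setP => X; apply/imsetP/imsetP.
    case=> -[[t s] [t' s']]; rewrite inE /= /ring_adj /ring_rel /=.
    case: (eqVneq s s') => [<-|].
      case/orP=> /eqP tE ->.
        exists (inl (s, t)) => //=; congr [set _; _]; congr (_, _).
        by apply: val_inj.
      exists (inl (s, t')) => //=; rewrite setUC.
      congr [set _; _]; congr (_, _).
      exact: val_inj.
    case: s s' => [] [] // _ /eqP tE ->.
      exists (inr t') => //=; rewrite setUC; congr [set _; _]; congr (_, _).
      by apply: val_inj; rewrite /= tE cross_layerK.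
    by exists (inr t) => //=; congr [set _; _]; congr (_, _); apply: val_inj.
  case=> -[[s t]|t] _ ->.
    by exists ((t, s), (su t, s));
      rewrite // inE /= /ring_adj /ring_rel /= !eqxx.
  by exists ((t, false), (cr t, true));
      rewrite // inE /= /ring_adj /ring_rel /= eqxx.
rewrite /cyclomatic edgesE card_imset //.
rewrite card_sum !card_prod card_bool !card_ord.
lia.
Qed.

(** Exactly what lets a list of layer-side pairs lift to a cycle of [ring_graph]. *)
Definition layered_cycle (c : seq (nat * bool)) : Prop :=
  [/\ cycle (ring_rel L) c, uniq c, 2 < size c & all (fun a => a.1 < L) c].

Definition edges_of (c : seq (nat * bool)) : {set {set ring_graph}} :=
  [set [set p.1; p.2] | p : ring_graph * ring_graph
     & consecutive c (layer_val p.1) (layer_val p.2)].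

Lemma edges_ofP (c : seq (nat * bool)) : layered_cycle c ->
  exists c' : seq ring_graph, [/\ [seq layer_val x | x <- c'] = c,
    ucycle (@adj ring_graph) c', 2 < size c' & edges_of c = cycle_edges c'].
Proof.
case=> cyc_c uniq_c size_c c_lt.
have [c' cE] : exists c' : seq T, [seq layer_val x | x <- c'] = c.
  elim: c c_lt {cyc_c uniq_c size_c} => [_|[t s] c IH /= /andP [tL cL]].
    by exists [::].
  by have [c' <-] := IH cL; exists ((Ordinal tL, s) :: c').
have lv_inj := layer_val_inj; rewrite -cE in cyc_c uniq_c size_c *.
rewrite size_map in size_c; rewrite map_inj_uniq // in uniq_c.
exists c'; split=> //.
  by rewrite /ucycle uniq_c andbT; move: cyc_c; rewrite cycle_map.
apply/setP => X; apply/imsetP/imsetP => [[[x y]]|[x xc ->]].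
  rewrite inE consecutive_map //= -cycle_edgesE => /imsetP [z zc ->] ->.
  by exists z.
exists (x, next c' x) => //.
by rewrite inE consecutive_map // /consecutive xc eqxx.
Qed.

Lemma edges_of_cycles (c : seq (nat * bool)) :
  layered_cycle c -> edges_of c \in cycles ring_graph.
Proof.
by move=> /edges_ofP [c' [_ uc sc ->]]; rewrite inE; apply/asboolP; exists c'.
Qed.

(** Allows cycles to be told apart by single edges, without returning to the finite graph. *)
Lemma edges_of_consecutive (c d : seq (nat * bool)) (a b : nat * bool) :
  layered_cycle c -> layered_cycle d -> edges_of c = edges_of d ->
  consecutive c a b -> consecutive d a b.
Proof.
move=> /edges_ofP [c' [<- /andP [_ uc] _ ->]].
move=> /edges_ofP [d' [<- /andP [_ ud] _ ->]] cdE.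
have lv_inj := layer_val_inj.
have mem_lv e v : v \in [seq layer_val x | x <- e] ->
    exists x : T, v = layer_val x.
  by case/mapP => x _ ->; exists x.
move=> cab; have /mem_lv [x ax] := consecutive_mem _ _ _ _ cab.
have /mem_lv [y yb] : b \in [seq layer_val x | x <- c'].
  by apply: (consecutive_mem _ _ _ a); rewrite /consecutive orbC.
move: cab; rewrite ax yb !consecutive_map //.
by rewrite -!cycle_edgesE cdE.
Qed.

End RingGraph.

(** * The cycles winding once around the ring *)

Section Winding.
Local Open Scope nat_scope.
Variables (L : nat) (L_ge : 5 < L) (y m : seq bool).

(* [y] gives the side of the connector used between successive 4-cycles, and
   [m] tells which 4-cycles are traversed along a single edge. *)
Definition side (k : nat) : bool := nth false y (k %% uphalf L).

(** The start of the connector into block [k], in the last layer of the cyclically preceding block.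
    The [minn] matters for odd [L], whose final block is the single layer [L.-1]. *)
Definition exit_vertex (k : nat) : nat * bool :=
  (if k is j.+1 then minn j.*2.+1 L.-1 else L.-1, side k).

(** The layers [2k] and [2k+1] are completely joined, so entry and exit sides are free; the two
    lists are the direct edge and the complementary path of three edges. The last branch is the lone
    rung of odd [L], crossed exactly when the sides differ. *)
Definition crossing (k : nat) : seq (nat * bool) :=
  let u := side k in let w := side k.+1 in
  if k.*2.+1 < L then
    if nth false m k then [:: (k.*2, u); (k.*2.+1, w)]
    else [:: (k.*2, u); (k.*2.+1, ~~ w); (k.*2, ~~ u); (k.*2.+1, w)]
  else if u == w then [:: (k.*2, u)] else [:: (k.*2, u); (k.*2, w)].

Definition winding : seq (nat * bool) :=
  flatten [seq crossing k | k <- iota 0 (uphalf L)].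

(** A closed form for the successor on [winding], meaningful only on its vertices; edges are decided
    by computing it. *)
Definition winding_next (a : nat * bool) : nat * bool :=
  let u := side a.1./2 in let w := side a.1./2.+1 in
  if odd a.1 then if a.2 == w then (succ_layer L a.1, w) else (a.1.-1, ~~ u)
  else if a.1.+1 < L then (a.1.+1, w (+) (~~ nth false m a.1./2 && (a.2 == u)))
  else if a.2 == w then (0, w) else (a.1, w).

Lemma side_period : side (uphalf L) = side 0.
Proof. by rewrite /side modnn mod0n. Qed.

Lemma crossing_step (k : nat) : k < uphalf L ->
  let e a b := ring_rel L a b && (winding_next a == b) in
  path e (exit_vertex k) (crossing k) /\
  last (exit_vertex k) (crossing k) = exit_vertex k.+1.
Proof.
move=> kM e.
have conn : e (exit_vertex k) (k.*2, side k).
  rewrite /e /ring_rel /winding_next /exit_vertex /=.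
  case: k kM => [|k] kM /=.
    (* At layer [L.-1] the exit side has index [uphalf L], the number of blocks, which wraps around
       to 0. *)
    have -> : (L.-1./2.+1) = uphalf L by lia.
    rewrite side_period !eqxx.
    by layers; rewrite eqxx ?andbT //=; layers.
  have -> : minn k.*2.+1 L.-1 = k.*2.+1 by lia.
  rewrite /= odd_double uphalf_double !eqxx /=.
  by layers; rewrite ?xpair_eqE ?eqxx; lia.
rewrite /crossing /=; case: ifP => kL.
  have kE : exit_vertex k.+1 = (k.*2.+1, side k.+1) by congr (_, _); lia.
  have half1 : uphalf k.*2 = k by lia.
  have half2 : k.*2./2 = k by lia.
  case: ifP => mk /=; rewrite conn kE.
    split=> //; rewrite andbT /e /ring_rel /winding_next /=.
    rewrite odd_double half2 kL mk addbF eqxx andbT.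
    by case: ifP => _; layers.
  split=> //; rewrite /e /ring_rel /winding_next /=.
  rewrite odd_double half2 half1 kL mk !eqxx /=.
  have cr1 : cross_layer L k.*2 = k.*2.+1 by layers.
  have cr2 : cross_layer L k.*2.+1 = k.*2 by layers.
  have su1 : succ_layer L k.*2 = k.*2.+1 by layers.
  rewrite cr1 cr2 su1.
  by case: (side k) (side k.+1) => [] [] /=; rewrite ?eqxx ?orbT.
have kE : exit_vertex k.+1 = (k.*2, side k.+1) by congr (_, _); lia.
case: eqP => [uw|/eqP uw] /=; rewrite conn kE ?uw //.
split=> //; rewrite andbT /e /ring_rel /winding_next /= odd_double.
rewrite (_ : k.*2./2 = k); last by lia.
rewrite kL (negbTE uw) eqxx andbT; layers.
Qed.

Lemma winding_cycle :
  cycle (ring_rel L) winding /\ fcycle winding_next winding.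
Proof.
have /(cycle_flatten_map _ _ exit_vertex) := crossing_step.
rewrite /exit_vertex side_period; case E: (uphalf L) => [|j]; first by lia.
rewrite (_ : minn _ _ = L.-1); last by lia.
move=> /(_ erefl) H; rewrite /winding E.
by split; apply: sub_cycle H => a b /andP [].
Qed.

Lemma mem_winding (a : nat * bool) : a \in winding ->
  a \in crossing a.1./2 /\ a.1./2 < uphalf L.
Proof.
case/flatten_mapP => k; rewrite mem_iota add0n /= => kM ak.
suff -> : a.1./2 = k by [].
by move: ak; rewrite /crossing; do 2!case: ifP => _; rewrite !inE;
  repeat case/orP; move=> /eqP -> /=; lia.
Qed.

Lemma winding_layered : layered_cycle L winding.
Proof.
have [cyc _] := winding_cycle.
split=> //.
- apply: (uniq_flatten_map _ (fun a => a.1./2)); first exact: iota_uniq.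
    move=> k _; rewrite /crossing; do 2!case: ifP => ? //=;
      rewrite !inE !xpair_eqE ?negb_or; lia.
  move=> k x; rewrite /crossing; do 2!case: ifP => _; rewrite !inE;
  repeat case/orP; move=> /eqP -> /=; lia.
- rewrite /winding (_ : uphalf L = (uphalf L - 2).+2); last by lia.
  rewrite /= !size_cat.
  have : 1 < size (crossing 0) by rewrite /crossing; layers.
  have : 1 < size (crossing 1) by rewrite /crossing; layers.
  lia.
- apply/allP => a /mem_winding []; move: (a.1./2) => k + kM.
  rewrite /crossing; do 2!case: ifP => ?; rewrite !inE;
  repeat case/orP; move=> /eqP -> /=; lia.
Qed.

Lemma winding_consecutive (a b : nat * bool) :
  consecutive winding a b ->
  (a \in winding) && (winding_next a == b) ||
  (b \in winding) && (winding_next b == a).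
Proof.
have [_ fc] := winding_cycle.
case/orP=> /andP [cH].
  by rewrite (fcycle_next_eq _ _ _ _ fc cH) => ->; rewrite cH.
by rewrite (fcycle_next_eq _ _ _ _ fc cH) => ->; rewrite cH orbT.
Qed.

(** With [winding_connector_side] this recovers [y]: of the two connectors into block [k], exactly
    the one on [side k] is used. *)
Lemma winding_connector (k : nat) : k < uphalf L ->
  consecutive winding (exit_vertex k) (k.*2, side k).
Proof.
move=> kM; have [_ fc] := winding_cycle.
have exit_mem j : j < uphalf L -> exit_vertex j.+1 \in winding.
  move=> jM; apply/flatten_mapP; exists j; first by rewrite mem_iota.
  have [_ <-] := crossing_step j jM.
  rewrite /crossing; do 2!case: ifP => _;
    rewrite /= ?mem_last !inE ?eqxx ?orbT //.
have vM : exit_vertex k \in winding.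
  case: k kM => [_|k kM]; last by apply: exit_mem; lia.
  rewrite (_ : exit_vertex 0 = exit_vertex (uphalf L).-1.+1).
    by apply: exit_mem; lia.
  rewrite /exit_vertex; congr (_, _); first by lia.
  by rewrite prednK ?side_period //; lia.
have [] := crossing_step k kM.
have : exists p, crossing k = (k.*2, side k) :: p.
  by rewrite /crossing; do 2!case: ifP => _; eexists.
case=> p -> /= /andP [/andP [_ /eqP nE] _] _.
by rewrite /consecutive vM (fcycle_next_eq _ _ _ _ fc vM) nE eqxx.
Qed.

(** [winding_next] never steps back a block and leaves a block only on the prescribed side. *)
Lemma winding_connector_side (k : nat) (s : bool) : k < uphalf L ->
  consecutive winding ((exit_vertex k).1, s) (k.*2, s) -> s = side k.
Proof.
move=> kM /winding_consecutive; rewrite /winding_next /exit_vertex /=.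
case: k kM => [|k] kM /=.
  have -> : (L.-1./2.+1) = uphalf L by lia.
  rewrite side_period.
  case/orP=> /andP [_]; last by layers; rewrite xpair_eqE; lia.
  by case: (s =P side 0) => // _; layers; rewrite ?xpair_eqE; lia.
have -> : minn k.*2.+1 L.-1 = k.*2.+1 by lia.
rewrite /= odd_double uphalf_double.
case/orP=> /andP [_].
  by case: (s =P side k.+1) => // _; layers; rewrite ?xpair_eqE; lia.
by rewrite /=; layers; rewrite xpair_eqE; lia.
Qed.

Lemma direct_mem (k : nat) : k < L./2 ->
  (k.*2, side k) \in winding.
Proof.
move=> kN; apply/flatten_mapP; exists k; first by rewrite mem_iota; lia.
by rewrite /crossing; do 2!case: ifP => _; rewrite inE eqxx.
Qed.

(** Recovers [m]: the detour of three edges avoids precisely the edge from entry to exit. *)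
Lemma winding_direct (k : nat) : k < L./2 ->
  consecutive winding (k.*2, side k) (k.*2.+1, side k.+1) = nth false m k.
Proof.
move=> kN; have [_ fc] := winding_cycle; have mem := direct_mem k kN.
have kL : k.*2.+1 < L by lia.
have nE : winding_next (k.*2, side k) =
    (k.*2.+1, side k.+1 (+) ~~ nth false m k).
  by rewrite /winding_next /= odd_double doubleK kL eqxx andbT.
apply/idP/idP => [/winding_consecutive|mk].
  rewrite nE mem /= xpair_eqE eqxx /=; case/orP.
    by case: (side _) (nth _ _ _) => [] [].
  rewrite /winding_next /= odd_double uphalf_double eqxx => /andP [_].
  by layers; rewrite xpair_eqE; lia.
by rewrite /consecutive mem (fcycle_next_eq _ _ _ _ fc mem) nE mk addbF eqxx.
Qed.

End Winding.

(** The connectors give [y] first; entry and exit vertices then agree, and the direct edges give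
    [m]. *)
Lemma winding_inj (L : nat) (L_ge : (5 < L)%N) (y m y' m' : seq bool) :
  size y = uphalf L -> size m = L./2 -> size y' = uphalf L -> size m' = L./2 ->
  (forall a b, consecutive (winding L y m) a b ->
               consecutive (winding L y' m') a b) ->
  (forall a b, consecutive (winding L y' m') a b ->
               consecutive (winding L y m) a b) ->
  y = y' /\ m = m'.
Proof.
move=> sy sm sy' sm' sub sub'.
have sideE k : (k < uphalf L)%N -> side L y k = side L y' k.
  move=> kM; apply: (winding_connector_side L L_ge y' m') => //.
  exact: sub (winding_connector L L_ge y m k kM).
have yE : y = y'.
  apply: (@eq_from_nth _ false) => [|k]; rewrite ?sy ?sy' // => kM.
  by have := sideE k kM; rewrite /side modn_small.
split=> //; subst y'.
apply: (@eq_from_nth _ false) => [|k]; rewrite ?sm ?sm' // => kN.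
rewrite -!(winding_direct L L_ge y) //.
by apply/idP/idP => [/sub|/sub'].
Qed.

(** * Cycles that go around almost the whole ring and come back *)

Section Excursion.
Local Open Scope nat_scope.
Variables (L : nat) (L_ge : 5 < L) (b : seq bool).

(* The connectors 2k-1 - 2k carry the bits of [false :: b]; fixing the bit at
   k = 0 identifies the two directions of travel of the same cycle. *)
Definition rail (t : nat) : bool := nth false (false :: b) (uphalf t %% L./2).

Definition pred_layer (t : nat) : nat := if t == 0 then L.-1 else t.-1.

Lemma rail0 : rail 0 = false.
Proof. by rewrite /rail mod0n. Qed.

Lemma rail_last : rail L.-1 = false.
Proof. by rewrite /rail (_ : uphalf L.-1 = L./2) ?modnn //; lia. Qed.

(** The rail switches sides only inside 4-cycles; it is constant along connectors, including those
    closing the ring. *)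
Lemma rail_succ (t : nat) : t < L ->
  rail (succ_layer L t) = rail t \/ ~~ odd t /\ t.+1 < L.
Proof.
move=> tL; rewrite /succ_layer; case: ifP => tL'; last first.
  left; rewrite rail0 -[RHS]/(rail t) (_ : t = L.-1) ?rail_last //; lia.
case: (boolP (odd t)) => t_odd; [left|by right].
by congr (nth _ _ (_ %% _)); lia.
Qed.

Lemma rung_rel (k : nat) (s s' : bool) : k.*2.+1 < L ->
  ring_rel L (k.*2, s) (k.*2.+1, s').
Proof. by move=> kL; rewrite /ring_rel /=; case: ifP => _; layers. Qed.

Lemma rail_rel (t : nat) (s : bool) : t < L ->
  ring_rel L (t, s (+) rail t) (succ_layer L t, s (+) rail (succ_layer L t)).
Proof.
move=> tL; case: (rail_succ t tL) => [->|[t_even tL']].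
  by rewrite /ring_rel /= !eqxx.
rewrite /succ_layer tL' (_ : t = t./2.*2); last by lia.
by apply: rung_rel; lia.
Qed.

Variables (i : nat) (i_gt0 : 0 < i) (i_lt : i < L./2).

(* The j-th vertex of the walk 2i, ..., L-1, 0, ..., 2i-1 along [rail],
   followed by 2i-2, ..., 0, L-1, ..., 2i+1 along its complement. *)
Definition excursion_layer (j : nat) : nat :=
  let q := if j < L then j else L.*2.-2 - j in
  if i.*2 + q < L then i.*2 + q else i.*2 + q - L.

Definition excursion_vertex (j : nat) : nat * bool :=
  (excursion_layer j, (L <= j < L.*2.-2) (+) rail (excursion_layer j)).

(** Indices run from 1 to [2L - 2]; the last one gives the start vertex, of index 0, again. *)
Definition excursion : seq (nat * bool) :=
  [seq excursion_vertex j.+1 | j <- iota 0 L.*2.-2].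

(** The special cases at layers [2i-1] and [2i+1] are the U-turns; no connector between layers
    [2i-1] and [2i] is used. *)
Definition excursion_next (a : nat * bool) : nat * bool :=
  if a.2 == rail a.1 then
    if a.1 == i.*2.-1 then (i.*2.-2, ~~ rail i.*2.-2)
    else (succ_layer L a.1, rail (succ_layer L a.1))
  else if a.1 == i.*2.+1 then (i.*2, rail i.*2)
  else (pred_layer a.1, ~~ rail (pred_layer a.1)).

Lemma excursion_layer_lt (j : nat) : excursion_layer j < L.
Proof. by rewrite /excursion_layer; layers. Qed.

Lemma excursion_next_rel (a : nat * bool) : a.1 < L ->
  ring_rel L a (excursion_next a).
Proof.
case: a => t s /= tL; rewrite /excursion_next /=.
case: (s =P rail t) => [->|/eqP s_rail].
  case: eqP => [->|_]; last by have := rail_rel t false tL.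
  rewrite ring_rel_sym /=; try lia.
  rewrite (_ : i.*2.-2 = i.-1.*2) 1?(_ : i.*2.-1 = i.-1.*2.+1); try lia.
  by apply: rung_rel; lia.
case: eqP => [->|_].
  by rewrite ring_rel_sym /=; try apply: rung_rel; lia.
have pL : pred_layer t < L by rewrite /pred_layer; layers.
have := rail_rel (pred_layer t) true pL.
rewrite (_ : succ_layer L (pred_layer t) = t);
  last by rewrite /pred_layer; layers.
have -> : s = true (+) rail t by case: s (rail t) s_rail => [] [].
by rewrite ring_rel_sym //; lia.
Qed.

Lemma excursion_next_vertex (j : nat) : j < L.*2.-2 ->
  excursion_next (excursion_vertex j) = excursion_vertex j.+1.
Proof.
move=> jn; rewrite /excursion_next /excursion_vertex /=.
case: (boolP (L <= j < L.*2.-2)) => jL /=.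
  rewrite (_ : (~~ _ == _) = false); last by case: (rail _).
  case: eqP => jE.
    have -> : excursion_layer j.+1 = i.*2.
      by move: jE; rewrite /excursion_layer; layers.
    rewrite (_ : (L <= j.+1 < L.*2.-2) = false) //.
    by move: jE; rewrite /excursion_layer; layers.
  have -> : excursion_layer j.+1 = pred_layer (excursion_layer j).
    by move: jE; rewrite /excursion_layer /pred_layer; layers.
  rewrite (_ : (L <= j.+1 < L.*2.-2)) //.
  by move: jE; rewrite /excursion_layer; layers.
rewrite eqxx; case: eqP => jE.
  have jL1 : j = L.-1 by move: jE; rewrite /excursion_layer; layers.
  have -> : excursion_layer j.+1 = i.*2.-2 by rewrite /excursion_layer; layers.
  by rewrite (_ : (L <= j.+1 < L.*2.-2)) //; lia.
have -> : excursion_layer j.+1 = succ_layer L (excursion_layer j).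
  by move: jE; rewrite /excursion_layer; layers.
rewrite (_ : (L <= j.+1 < L.*2.-2) = false) //.
by move: jE; rewrite /excursion_layer; layers.
Qed.

Lemma excursion_cycle :
  cycle (ring_rel L) excursion /\ fcycle excursion_next excursion.
Proof.
pose e a b := ring_rel L a b && (excursion_next a == b).
suff H : cycle e excursion.
  by split; apply: sub_cycle H => a c /andP [].
rewrite /excursion -flatten_map1.
apply: (cycle_flatten_map _ _ excursion_vertex).
  rewrite /excursion_vertex ltnn andbF (_ : L <= 0 = false); last by lia.
  have -> : excursion_layer 0 = excursion_layer L.*2.-2.
    by rewrite /excursion_layer; layers.
  by [].
move=> j jn; split=> //=.
rewrite andbT /e -excursion_next_vertex // eqxx andbT.
by apply: excursion_next_rel; apply: excursion_layer_lt.
Qed.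

Lemma excursion_layered : layered_cycle L excursion.
Proof.
have [cyc _] := excursion_cycle; split=> //.
- rewrite map_inj_in_uniq ?iota_uniq // => j j'; rewrite !mem_iota => jn jn'.
  rewrite /excursion_vertex => -[lE]; rewrite lE => /addIb fE.
  by move: lE; rewrite /excursion_layer; layers.
- by rewrite size_map size_iota; lia.
- by apply/allP => _ /mapP [j _ ->]; apply: excursion_layer_lt.
Qed.

Lemma mem_excursion (t : nat) (s : bool) : t < L ->
  ((t, s) \in excursion) = [|| s == rail t | (t != i.*2.-1) && (t != i.*2)].
Proof.
(* [q] is the distance from layer [2i] to [t] in the outward direction: the complement meets [t] at
   index [2L-2-q], the rail at index [q], or at [2L-2] if [q] is 0. *)
move=> tL; pose q := if i.*2 <= t then t - i.*2 else t + L - i.*2.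
apply/mapP/idP => [[j]|].
  rewrite mem_iota /excursion_vertex => jn [-> ->].
  case: (boolP (L <= j.+1 < L.*2.-2)) => jL /=; last by rewrite eqxx.
  by apply/orP; right; rewrite /excursion_layer; layers.
case: (s =P rail t) => [-> _|/eqP s_rail /= tN].
  have qE : excursion_layer (if q == 0 then L.*2.-2 else q) = t.
    by rewrite /excursion_layer /q; layers.
  exists (if q == 0 then L.*2.-2 else q).-1.
    by rewrite mem_iota /q; layers.
  rewrite prednK; last by rewrite /q; layers.
  rewrite /excursion_vertex qE; congr (_, _).
  by rewrite (_ : _ && _ = false) // /q; layers.
have qE : excursion_layer (L.*2.-2 - q) = t.
  by rewrite /excursion_layer /q; layers.
exists (L.*2.-2 - q).-1; first by rewrite mem_iota /q; layers.
rewrite prednK; last by rewrite /q; layers.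
rewrite /excursion_vertex qE; congr (_, _).
rewrite (_ : _ && _ = true); last by rewrite /q; layers.
by case: s (rail t) s_rail => [] [].
Qed.

Lemma excursion_consecutive (a c : nat * bool) : consecutive excursion a c ->
  (a \in excursion) && (excursion_next a == c) ||
  (c \in excursion) && (excursion_next c == a).
Proof.
have [_ fc] := excursion_cycle.
case/orP=> /andP [cH].
  by rewrite (fcycle_next_eq _ _ _ _ fc cH) => ->; rewrite cH.
by rewrite (fcycle_next_eq _ _ _ _ fc cH) => ->; rewrite cH orbT.
Qed.

Lemma excursion_rail (t : nat) : t < L -> t != i.*2.-1 ->
  consecutive excursion (t, rail t) (succ_layer L t, rail (succ_layer L t)).
Proof.
move=> tL tN; have [_ fc] := excursion_cycle.
have mem : (t, rail t) \in excursion by rewrite mem_excursion // eqxx.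
rewrite /consecutive mem (fcycle_next_eq _ _ _ _ fc mem) /excursion_next /=.
by rewrite eqxx (negbTE tN) eqxx.
Qed.

(** The rail is [false] at both ends, so it takes one closing connector and its complement the
    other; [0 < i] keeps the U-turns away from this place. *)
Lemma excursion_both_connectors (s : bool) :
  consecutive excursion (L.-1, s) (0, s).
Proof.
have [_ fc] := excursion_cycle.
case: s; last first.
  have := excursion_rail L.-1; rewrite rail_last.
  have -> : succ_layer L L.-1 = 0 by layers.
  by rewrite rail0; apply; lia.
have mem : (0, true) \in excursion by rewrite mem_excursion; lia.
rewrite /consecutive mem (fcycle_next_eq _ _ _ _ fc mem) /excursion_next /=.
by rewrite rail0 /pred_layer eqxx rail_last eqxx orbT.
Qed.

End Excursion.

(** The missed vertices give [i] and the side of the rail at layer [2i]; agreement elsewhere spreads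
    from the two ends, where every rail is [false]. *)
Lemma excursion_inj (L : nat) (L_ge : (5 < L)%N)
    (i i' : nat) (b b' : seq bool) :
  (0 < i)%N -> (i < L./2)%N -> (0 < i')%N -> (i' < L./2)%N ->
  size b = L./2.-1 -> size b' = L./2.-1 ->
  (forall a c, consecutive (excursion L b i) a c ->
               consecutive (excursion L b' i') a c) ->
  (forall a c, consecutive (excursion L b' i') a c ->
               consecutive (excursion L b i) a c) ->
  i = i' /\ b = b'.
Proof.
move=> i_gt0 i_lt i_gt0' i_lt' sb sb' sub sub'.
have mem_sub a : a \in excursion L b i -> a \in excursion L b' i'.
  move=> H; apply: (consecutive_mem _ _ _ (next (excursion L b i) a)).
  by apply: sub; rewrite /consecutive H eqxx.
have mem_sub' a : a \in excursion L b' i' -> a \in excursion L b i.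
  move=> H; apply: (consecutive_mem _ _ _ (next (excursion L b' i') a)).
  by apply: sub'; rewrite /consecutive H eqxx.
have ii' : i = i'.
  (* The first cycle misses this vertex, hence so does the second; parity then leaves only
     [i.*2 = i'.*2]. *)
  have := mem_sub' (i.*2, ~~ rail L b i.*2).
  by rewrite !mem_excursion //=; lia.
subst i'; split=> //.
have rail_i : rail L b i.*2 = rail L b' i.*2.
  have := mem_sub (i.*2, rail L b i.*2).
  by rewrite !mem_excursion //=; lia.
(* Away from the U-turns, an edge of the second cycle between successive layers stays on its rail or
   on its complement. *)
have step t : (t < L)%N ->
    (t != i.*2.-2)%N -> (t != i.*2.-1)%N -> (t != i.*2)%N ->
    (rail L b t == rail L b' t) =
      (rail L b (succ_layer L t) == rail L b' (succ_layer L t)).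
  move=> tL t2 t1 t0.
  have := excursion_rail L L_ge b i i_gt0 i_lt t tL t1.
  move=> /sub/(excursion_consecutive _ L_ge _ _ i_gt0 i_lt).
  rewrite /excursion_next /=.
  have succN : (succ_layer L (succ_layer L t) == t)%N = false by layers.
  have predK : pred_layer L (succ_layer L t) = t by rewrite /pred_layer; layers.
  have predN : (pred_layer L t == succ_layer L t)%N = false.
    by rewrite /pred_layer; layers.
  case/orP=> /andP [_].
    case: (rail L b t =P _) => _.
      by rewrite (negbTE t1) xpair_eqE eqxx eq_sym.
    case: (t =P _) => [->|_]; rewrite xpair_eqE ?predN //.
    by move=> /andP [H _]; exfalso; move: H; layers.
  case: (rail L b (succ_layer L t) =P _) => _.
    case: (_ =P i.*2.-1) => _;
      by rewrite xpair_eqE ?succN // eq_sym (negbTE t2).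
  case: (_ =P i.*2.+1) => _; first by rewrite xpair_eqE eq_sym (negbTE t0).
  rewrite predK xpair_eqE => /andP [_].
  by case: (rail L b t) (rail L b' t) => [] [].
have up t : (t <= i.*2.-2)%N -> rail L b t = rail L b' t.
  elim: t => [_|t IH ti]; first by rewrite !rail0.
  have := step t; rewrite IH; last by lia.
  rewrite /succ_layer ifT; last by lia.
  by rewrite eqxx => H; apply/esym/eqP; rewrite eq_sym -H; lia.
have down d : (i.*2 < L.-1 - d)%N -> rail L b (L.-1 - d) = rail L b' (L.-1 - d).
  elim: d => [_|d IH di]; first by rewrite subn0 !rail_last.
  have := step (L.-1 - d.+1)%N; rewrite /succ_layer ifT; last by lia.
  rewrite (_ : (L.-1 - d.+1).+1 = L.-1 - d)%N; last by lia.
  rewrite IH; last by lia.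
  by rewrite eqxx => H; apply/eqP; apply: H; lia.
have railE k : (k < L./2)%N -> rail L b k.*2 = rail L b' k.*2.
  move=> kN; case: (ltngtP k i) => ki; last by rewrite ki.
    by apply: up; lia.
  by rewrite (_ : k.*2 = L.-1 - (L.-1 - k.*2))%N; [apply: down|]; lia.
apply: (@eq_from_nth _ false) => [|k]; rewrite ?sb ?sb' // => kN.
have kN' : (k.+1 < L./2)%N by lia.
(* The prepended [false] shifts bit [k] of [b] to layer [2(k+1)]. *)
have := railE k.+1 kN'; rewrite /rail uphalf_double.
by rewrite modn_small.
Qed.

(** * Counting both families *)

Section Counting.
Local Open Scope nat_scope.
Variables (L : nat) (L_ge : 5 < L).

Let L_ge3 : 2 < L. Proof. lia. Qed.

(** A winding cycle uses one of the two connectors closing the ring, an excursion both. *)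
Lemma winding_excursion_disjoint (y m b : seq bool) (i : nat) :
  0 < i -> i < L./2 ->
  edges_of L L_ge3 (winding L y m) <> edges_of L L_ge3 (excursion L b i).
Proof.
move=> i_gt0 i_lt /esym E.
have connector s : s = side L y 0.
  apply: (winding_connector_side L L_ge y m) => //; first by lia.
  apply: (edges_of_consecutive _ L_ge3 _ _ _ _ _ _ E).
  - exact: excursion_layered.
  - exact: winding_layered.
  - exact: excursion_both_connectors.
by have := connector true; rewrite -(connector false).
Qed.

Lemma card_cycles_ring_graph :
  2 ^ L + L./2.-1 * 2 ^ L./2.-1 <= #|cycles (ring_graph L L_ge3)|.
Proof.
pose w (p : (uphalf L).-tuple bool * (L./2).-tuple bool) :=
  edges_of L L_ge3 (winding L p.1 p.2).
(* The ordinal is shifted by one because [i] ranges over [1, ..., L./2.-1]. *)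
pose x (p : 'I_(L./2.-1) * (L./2.-1).-tuple bool) :=
  edges_of L L_ge3 (excursion L p.2 (val p.1).+1).
have w_inj : injective w.
  move=> [y m] [y' m'] E.
  have [] : val y = val y' /\ val m = val m';
    last by move=> /val_inj -> /val_inj ->.
  have W p q := winding_layered L L_ge p q.
  apply: (winding_inj L L_ge); rewrite ?size_tuple // => a c.
    exact: edges_of_consecutive (W _ _) (W _ _) E.
  exact: edges_of_consecutive (W _ _) (W _ _) (esym E).
have i_lt (i : 'I_(L./2.-1)) : i.+1 < L./2 by have := ltn_ord i; lia.
have x_inj : injective x.
  move=> [i b] [i' b'] E.
  have W (j : 'I_(L./2.-1)) p :=
    excursion_layered L L_ge p j.+1 (ltn0Sn _) (i_lt j).
  have [] : (val i).+1 = (val i').+1 /\ val b = val b'.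
    apply: (excursion_inj L L_ge); rewrite ?size_tuple //;
      try exact: i_lt; move=> a c.
      exact: edges_of_consecutive (W _ _) (W _ _) E.
    exact: edges_of_consecutive (W _ _) (W _ _) (esym E).
  by move=> [/val_inj ->] /val_inj ->.
have <- : #|[set w p | p in predT] :|: [set x p | p in predT]|
    = 2 ^ L + L./2.-1 * 2 ^ L./2.-1.
  rewrite cardsU disjoint_setI0 ?cards0 ?subn0; last first.
    apply/pred0P => C /=; apply/andP => -[/imsetP [p _ ->] /imsetP [q _]].
    exact: winding_excursion_disjoint (ltn0Sn _) (i_lt _).
  rewrite !card_imset // !card_prod !card_tuple card_bool card_ord -expnD.
  by congr (2 ^ _ + _); lia.
apply/subset_leq_card/subsetP => C.
case/setUP => /imsetP [p _ ->]; apply: edges_of_cycles.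
  exact: winding_layered.
exact: (excursion_layered _ L_ge _ _ (ltn0Sn _) (i_lt _)).
Qed.

Lemma Psi_ge : 2 ^ L + L./2.-1 * 2 ^ L./2.-1 <= Psi L.+1.
Proof.
apply: leq_trans card_cycles_ring_graph _.
rewrite /Psi; case: ex_maxnP => n _; apply; apply/asboolP.
exists (ring_graph L L_ge3); split=> //.
  exact: ring_graph_connected.
exact: ring_graph_cyclomatic.
Qed.

End Counting.

Theorem theorem1p7 (R : realType) :
  exists c : R, 0 < c /\
    exists r0 : nat, forall r : nat, (r0 <= r)%N ->
      2 `^ (r%:R - 1) + c * r%:R * 2 `^ (r%:R / 2) <= (Psi r)%:R.
Proof.
(* With [r = L + 1], one factor 4 of 16 bounds [2 ^ (r/2)] by [4 * 2 ^ (L./2.-1)], the other bounds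
   [r] by [4 * L./2.-1], which holds from [L = 6] on, that is, [r = 7]. *)
exists 16^-1; split; first by rewrite invr_gt0.
exists 7; case=> // L L_ge.
have L_ge5 : (5 < L)%N by lia.
apply: (@le_trans _ _ (2 ^ L + L./2.-1 * 2 ^ L./2.-1)%:R); last first.
  by rewrite ler_nat; exact: Psi_ge.
rewrite natrD lerD //.
  by rewrite -[L.+1]addn1 natrD addrK powR_mulrn // natrX.
have powE : 2 `^ (L.+1%:R / 2) <= 2 ^+ (L./2.+1) :> R.
  rewrite -powR_mulrn // ler_powR // ?ler1n // ler_pdivrMr // -natrM ler_nat.
  lia.
apply: (@le_trans _ _ (16^-1 * L.+1%:R * 2 ^+ L./2.+1)).
  by rewrite ler_wpM2l // mulr_ge0 // invr_ge0.
rewrite -mulrA mulrC ler_pdivrMr // -natrX -!natrM ler_nat.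
rewrite (_ : L./2.+1 = L./2.-1 + 2)%N; last by lia.
rewrite expnD [(L./2.-1 * _ * _)%N]mulnAC mulnCA.
rewrite [X in (_ <= X)%N]mulnC leq_mul2l; lia.
Qed.
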